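(* Let $p,q\ge1$ be integers and consider the pseudo-sphere $\mathbb S^{(q,p)}=\mathbb S^q\times\mathbb S^p$ with the metric $g=g_{\mathbb S^q}-g_{\mathbb S^p}$. Then, as formal power series in $r$, $$\mathcal G\Big(\frac{r^2}4\Big)=\sqrt{v(r)},\qquad\text{where}\quad \mathcal G(r)=1+\sum_{N\ge1}(-1)^N\Lambda_{2N}\frac{r^N}{N!\,(N-1)!}.$$
   Context: Here $g_{\mathbb S^q}$, $g_{\mathbb S^p}$ are the unit round metrics, and $n=p+q$. $\Delta_{\mathbb S^q},\Delta_{\mathbb S^p}$ are the (non-positive) Laplacians of the factors. Put $B^2=-\Delta_{\mathbb S^q}+(\frac{q-1}2)^2$ and $C^2=-\Delta_{\mathbb S^p}+(\frac{p-1}2)^2$. The GJMS-operators of $\mathbb S^{(q,p)}$ are $$P_{4N}=\prod_{j=1}^N\big[(B^2-C^2)^2-2(2j-1)^2(B^2+C^2)+(2j-1)^4\big],\quad N\ge1,$$ $$P_{4N+2}=(-B^2+C^2)\prod_{j=1}^N\big[(B^2-C^2)^2-2(2j)^2(B^2+C^2)+(2j)^4\big],\quad N\ge0.$$ The $Q$-curvatures are defined by $P_{2N}(1)=(-1)^N(\frac n2-N)Q_{2N}$ (for $2N=n$ by continuation in the dimension); here they are the constants $$Q_{2N}=\prod_{j=1}^{N-1}\Big(\frac{p+q}2+N-2j\Big)\prod_{j=0}^{N-1}\Big(\frac{q-p}2-N+1+2j\Big),\quad N\ge1.$$ For a composition $I=(I_1,\dots,I_r)$ (finite sequence of integers $I_j\ge1$)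 put $|I|=I_1+\dots+I_r$, $P_{2I}=P_{2I_1}\circ\cdots\circ P_{2I_r}$ and $$m_I=-(-1)^r|I|!\,(|I|-1)!\prod_{j=1}^r\frac1{I_j!\,(I_j-1)!}\prod_{j=1}^{r-1}\frac1{I_j+I_{j+1}}.$$ The primary part $\mathcal Q_{2N}$ of $Q_{2N}$ is defined by $\mathcal Q_2=0$ and, for $N\ge2$, $(-1)^N\mathcal Q_{2N}=-\sum_{a+|J|=N,\ a\ne N}m_{(J,a)}(-1)^aP_{2J}(Q_{2a})$, where $J$ runs over compositions and $a\ge1$ over integers. Set $\Lambda_{2N}=Q_{2N}-\mathcal Q_{2N}$. The Poincaré-Einstein metric associated to $g$ is $g_+=r^{-2}(dr^2+g_r)$ with $g_r=(1-r^2/4)^2g_{\mathbb S^q}-(1+r^2/4)^2g_{\mathbb S^p}$, and $v(r)=\mathrm{vol}(g_r)/\mathrm{vol}(g)=(1-r^2/4)^q(1+r^2/4)^p$. *)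

(* Defs.v *)
From HB Require Import structures.
From mathcomp Require Import all_boot all_order all_algebra.
From mathcomp Require Import boolp classical_sets reals topology normedtype derive.
Set Implicit Arguments.
Unset Strict Implicit.
Unset Printing Implicit Defensive.
Import Order.TTheory GRing.Theory Num.Theory.
Import numFieldNormedType.Exports.
Local Open Scope ring_scope.

(** * The round sphere and its Laplacian *)

(* The library norm on ['rV[R]_n] is the sup norm, hence this definition. *)
Definition enorm (R : realType) (n : nat) (x : 'rV[R]_n) : R :=
  Num.sqrt (\sum_(i < n) x 0 i ^+ 2).

(* S^n as the unit sphere of R^(n+1). *)
Definition sphere (R : realType) (n : nat) : Type :=
  {x : 'rV[R]_n.+1 | enorm x == 1}.

Lemma enorm_delta (R : realType) (n : nat) (i : 'I_n) :
  enorm (delta_mx 0 i : 'rV[R]_n) == 1.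
Proof.
rewrite /enorm (bigD1 i) //= mxE !eqxx /= expr1n big1 ?addr0 ?sqrtr1 //.
by move=> j ji; rewrite mxE eqxx (negbTE ji) expr0n.
Qed.

(* Radial projection y |-> y / |y|; its value at y = 0 is irrelevant, since
   derivatives are only taken at points of the sphere. *)
Definition sphere_proj (R : realType) (n : nat) (y : 'rV[R]_n.+1) :
    sphere R n :=
  insubd (exist _ (delta_mx 0 ord0) (enorm_delta R ord0) : sphere R n)
         ((enorm y)^-1 *: y).

(* [sphere_partial i f x] is the derivative at x of f in the direction of the
   tangential component of the i-th basis vector: the degree 0 homogeneous
   extension of f is constant in the radial direction. *)
Definition sphere_partial (R : realType) (n : nat) (i : 'I_n.+1)
    (f : sphere R n -> R) (x : sphere R n) : R :=
  'D_(delta_mx 0 i) (fun y : 'rV[R]_n.+1 => f (sphere_proj y) : R^o) (val x).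

(* Gradient for the round metric, a tangent vector of R^(n+1). *)
Definition sphere_grad (R : realType) (n : nat)
    (f : sphere R n -> R) (x : sphere R n) : 'rV[R]_n.+1 :=
  \row_i sphere_partial i f x.

(* Divergence: the trace over the tangent space of the derivative of a
   tangent vector field (the normal part of the derivative of the field does
   not contribute). *)
Definition sphere_div (R : realType) (n : nat)
    (X : sphere R n -> 'rV[R]_n.+1) (x : sphere R n) : R :=
  \sum_(i < n.+1) sphere_partial i (fun y => X y 0 i) x.

(* Non-positive Laplacian div grad.  Like [derive], this is a total operator,
   meaningful on smooth functions. *)
Definition sphere_laplacian (R : realType) (n : nat)
    (f : sphere R n -> R) : sphere R n -> R :=
  sphere_div (sphere_grad f).

(** * Operators on the pseudo-sphere S^q x S^p *)

Definition func (R : realType) (q p : nat) : Type :=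
  sphere R q * sphere R p -> R.

Definition laplacian_q (R : realType) (q p : nat) (f : func R q p) :
    func R q p :=
  fun z => sphere_laplacian (fun x => f (x, z.2)) z.1.

Definition laplacian_p (R : realType) (q p : nat) (f : func R q p) :
    func R q p :=
  fun z => sphere_laplacian (fun y => f (z.1, y)) z.2.

Definition opB2 (R : realType) (q p : nat) (f : func R q p) : func R q p :=
  fun z => - laplacian_q f z + ((q%:R - 1) / 2) ^+ 2 * f z.

Definition opC2 (R : realType) (q p : nat) (f : func R q p) : func R q p :=
  fun z => - laplacian_p f z + ((p%:R - 1) / 2) ^+ 2 * f z.

(* B^2 - C^2 *)
Definition opD (R : realType) (q p : nat) (f : func R q p) : func R q p :=
  fun z => opB2 f z - opC2 f z.

(* (B^2 - C^2)^2 - 2 k^2 (B^2 + C^2) + k^4 *)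
Definition gjms_factor (R : realType) (q p k : nat) (f : func R q p) :
    func R q p :=
  fun z => opD (opD f) z - 2 * k%:R ^+ 2 * (opB2 f z + opC2 f z)
           + k%:R ^+ 4 * f z.

Definition compose_all (T : Type) (s : seq (T -> T)) : T -> T :=
  foldr (fun A B => A \o B) id s.

(* [gjms N] is P_{2N}; so N even is the case P_{4M} and N odd the case
   P_{4M+2}, with M = N./2. *)
Definition gjms (R : realType) (q p N : nat) (f : func R q p) : func R q p :=
  let M := N./2 in
  if odd N then
    fun z => - opD (compose_all
      [seq @gjms_factor R q p (2 * j)%N | j <- iota 1 M] f) z
  else
    compose_all [seq @gjms_factor R q p (2 * j - 1)%N | j <- iota 1 M] f.

Definition gjms_comp (R : realType) (q p : nat) (I : seq nat) :
    func R q p -> func R q p :=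
  compose_all [seq @gjms R q p j | j <- I].

(** * Compositions and the coefficients m_I *)

(* The compositions of n.+1 arise from those of n by prepending a part 1 or
   by increasing the first part. *)
Fixpoint compositions (n : nat) : seq (seq nat) :=
  if n is m.+1 then
    [seq 1%N :: s | s <- compositions m] ++
    [seq (head 0%N s).+1 :: behead s | s <- compositions m & s != [::]]
  else [:: [::]].

Lemma mem_compositions (n : nat) (s : seq nat) :
  (s \in compositions n) = all (leq 1) s && (sumn s == n).
Proof.
elim: n s => [|n IHn] s /=.
  by case: s => [|[|i] s] //=; rewrite addSn andbF.
rewrite mem_cat; apply/orP/idP => [[]|].
- case/mapP=> t; rewrite IHn => /andP[tp /eqP tn] ->.
  by rewrite /= tp tn add1n eqxx.
- case/mapP=> -[|i t]; rewrite mem_filter //= IHn /=.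
  by case/andP=> /andP[_ tp] /eqP <- ->; rewrite /= tp addSn eqxx.
case: s => [|[|[|i]] s] //= /andP[sp /eqP].
  rewrite add1n => -[sn]; left; apply/mapP; exists s => //.
  by rewrite IHn sp sn eqxx.
rewrite addSn => -[sn]; right; apply/mapP; exists (i.+1 :: s) => //.
by rewrite mem_filter /= IHn /= sp sn eqxx.
Qed.

Lemma uniq_compositions (n : nat) : uniq (compositions n).
Proof.
elim: n => //= n IHn; rewrite cat_uniq map_inj_uniq ?IHn => [|s t []] //=.
apply/andP; split.
  apply/hasPn => u /mapP[[|i s]]; rewrite mem_filter //= mem_compositions /=.
  by case: i => //= i _ ->; apply/mapP => -[t _].
rewrite map_inj_in_uniq ?filter_uniq // => -[|i s] [|j t];
  rewrite !mem_filter //= => _ _.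
by case=> -> ->.
Qed.

Definition m_coef (R : realType) (I : seq nat) : R :=
  - (-1) ^+ size I * (sumn I)`!%:R * (sumn I).-1`!%:R
  * (\prod_(j < size I) ((nth 0%N I j)`!%:R * (nth 0%N I j).-1`!%:R)^-1)
  * (\prod_(j < (size I).-1) ((nth 0%N I j + nth 0%N I j.+1)%:R)^-1).

(** * Q-curvatures and their primary parts *)

(* [Qcurv q p N] is the constant Q_{2N}. *)
Definition Qcurv (R : realType) (q p N : nat) : R :=
  (\prod_(1 <= j < N) ((p%:R + q%:R) / 2 + N%:R - 2 * j%:R))
  * (\prod_(0 <= j < N) ((q%:R - p%:R) / 2 - N%:R + 1 + 2 * j%:R)).

(* The primary part of Q_{2N}, as a function on S^q x S^p.  The index a ranges
   over 1 <= a <= N - 1 and J over the compositions of N - a; for N = 1 the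
   sum is empty, in accordance with the primary part of Q_2 being 0. *)
Definition primaryQ (R : realType) (q p N : nat) : func R q p :=
  fun z => (-1) ^+ N *
    - \sum_(1 <= a < N) \sum_(J <- compositions (N - a))
        m_coef R (rcons J a) * (-1) ^+ a
        * gjms_comp J (fun _ => Qcurv R q p a) z.

Definition Lambda (R : realType) (q p N : nat) : func R q p :=
  fun z => Qcurv R q p N - primaryQ N z.

(** * Formal power series, as coefficient sequences *)

Definition fps (R : realType) : Type := nat -> R.

Definition fps_of_poly (R : realType) (u : {poly R}) : fps R :=
  fun n => u`_n.

Definition fps_mul (R : realType) (a b : fps R) : fps R :=
  fun n => \sum_(i < n.+1) a i * b (n - i)%N.

(* a(u(r)) for a polynomial u without constant term: the powers u^j with
   j > n do not contribute to the coefficient of r^n. *)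
Definition fps_subst (R : realType) (a : fps R) (u : {poly R}) : fps R :=
  fun n => \sum_(j < n.+1) a j * (u ^+ j)`_n.

(* First n coefficients of the square root with constant term 1 of a power
   series with constant term 1. *)
Fixpoint fps_sqrt_coefs (R : realType) (a : fps R) (n : nat) : seq R :=
  if n is m.+1 then
    let s := fps_sqrt_coefs a m in
    rcons s (if m == 0%N then 1
             else (a m - \sum_(1 <= i < m) s`_i * s`_(m - i)) / 2)
  else [::].

Definition fps_sqrt (R : realType) (a : fps R) : fps R :=
  fun n => (fps_sqrt_coefs a n.+1)`_n.

Lemma size_fps_sqrt_coefs (R : realType) (a : fps R) n :
  size (fps_sqrt_coefs a n) = n.
Proof. by elim: n => //= n IHn; rewrite size_rcons IHn. Qed.

Lemma nth_fps_sqrt_coefs (R : realType) (a : fps R) n i : (i < n)%N ->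
  (fps_sqrt_coefs a n)`_i = fps_sqrt a i.
Proof.
elim: n => // n IHn; rewrite ltnS leq_eqVlt => /orP[/eqP->//|lt_in] /=.
by rewrite nth_rcons size_fps_sqrt_coefs lt_in IHn.
Qed.

Lemma fps_sqrt0 (R : realType) (a : fps R) : fps_sqrt a 0%N = 1.
Proof. by []. Qed.

Lemma fps_sqrtS (R : realType) (a : fps R) n :
  fps_sqrt a n.+1 =
  (a n.+1 - \sum_(1 <= i < n.+1) fps_sqrt a i * fps_sqrt a (n.+1 - i)%N) / 2.
Proof.
rewrite {1}/fps_sqrt -[fps_sqrt_coefs _ _]/(rcons (fps_sqrt_coefs a n.+1) _).
rewrite nth_rcons size_fps_sqrt_coefs ltnn eqxx /=.
congr ((_ - _) / _); apply: eq_big_nat => i /andP[i0 lt_in].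
rewrite -[rcons _ _]/(fps_sqrt_coefs a n.+1) !nth_fps_sqrt_coefs //.
by rewrite ltn_subrL i0.
Qed.

Lemma fps_mul_selfS (R : realType) (s : fps R) n : s 0%N = 1 ->
  fps_mul s s n.+1 =
  2 * s n.+1 + \sum_(1 <= i < n.+1) s i * s (n.+1 - i)%N.
Proof.
move=> s0; rewrite /fps_mul -(big_mkord xpredT (fun i => s i * s (n.+1 - i)%N)).
rewrite big_nat_recr // big_ltn //= subnn subn0 s0 mul1r mulr1.
by rewrite mulrDl mul1r addrAC.
Qed.

Lemma fps_sqrtK (R : realType) (a : fps R) : a 0%N = 1 ->
  fps_mul (fps_sqrt a) (fps_sqrt a) =1 a.
Proof.
move=> a0 [|n]; first by rewrite /fps_mul big_ord1 subnn fps_sqrt0 mulr1 a0.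
by rewrite fps_mul_selfS // fps_sqrtS mulrC divfK ?pnatr_eq0 // subrK.
Qed.

Lemma fps_sqrt_unique (R : realType) (a s : fps R) : s 0%N = 1 ->
  fps_mul s s =1 a -> s =1 fps_sqrt a.
Proof.
move=> s0 sa n; elim/ltn_ind: n => -[|n] IHn; first by rewrite s0.
rewrite fps_sqrtS -sa fps_mul_selfS //.
have -> : \sum_(1 <= i < n.+1) fps_sqrt a i * fps_sqrt a (n.+1 - i)%N =
          \sum_(1 <= i < n.+1) s i * s (n.+1 - i)%N.
  by apply: eq_big_nat => i /andP[i0 lt_in]; rewrite !IHn // ltn_subrL i0.
by rewrite addrK mulrC mulKf ?pnatr_eq0.
Qed.

(* The series G, with coefficients in the functions on S^q x S^p, at z. *)
Definition calG (R : realType) (q p : nat) (z : sphere R q * sphere R p) :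
    fps R :=
  fun N => if N == 0%N then 1
           else (-1) ^+ N * Lambda N z / (N`!%:R * N.-1`!%:R).

(* v(r) = vol(g_r) / vol(g) for g_r = (1 - r^2/4)^2 g_{S^q}
   - (1 + r^2/4)^2 g_{S^p}; here ['X] is the variable r. *)
Definition vol_ratio (R : realType) (q p : nat) : {poly R} :=
  (1 - 4^-1 *: 'X^2) ^+ q * (1 + 4^-1 *: 'X^2) ^+ p.

(* Main.v *)
Require Import Defs.
From HB Require Import structures.
From mathcomp Require Import all_boot all_order all_algebra.
From mathcomp Require Import ring zify.
From mathcomp Require Import boolp reals topology normedtype derive.
Set Implicit Arguments.
Unset Strict Implicit.
Unset Printing Implicit Defensive.
Import Order.TTheory GRing.Theory Num.Theory.
Import numFieldNormedType.Exports.
Local Open Scope ring_scope.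

(** The Laplacians kill constants, so P_{2J} acts on the constant Q_{2a} by a
    scalar.  Put h = (p + q) / 2, y = (q - p) / 2, al = (h + y) / 2 = q / 2 and
    be = (h - y) / 2 = p / 2.  Pairing the linear factors gives
      P_{2N}(1) = (-1)^N prod_{k < N} (h - N + 2k) (y + 1 - N + 2k),
    and with c_N = - P_{2N}(1) / (N! (N-1)!) the N-th coefficient of G becomes
    a sum over the compositions (J_1, ..., J_r, a) of N of the product of
    c_{J_1}, ..., c_{J_r}, of the reciprocals of the sums of adjacent parts, and
    of v_a = (-1)^a Q_{2a} / (a! (a-1)!), where (a - h) v_a = c_a.

    Read from the right, such a sum is governed by the power series phi_z(s)
    ([comp_sum]) which solve
      phi_z = 1 + sum_{l >= 1} c_l / (z + l) s^l phi_l.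
    This is the equation of inverse scattering: each coefficient of phi_z is
    rational in z, and the residue of phi_z at z = -l is c_l s^l phi_l. So
    phi_z should satisfy, with theta = s d/ds, a Schroedinger equation
      theta^2 phi + z theta phi = V phi
    whose potential V does not depend on z.  Here V is the Poeschl-Teller
    potential al (al-1) s / (1-s)^2 - be (be-1) s / (1+s)^2.  To prove it, one
    only needs the obstruction to solving the equation at z = -N, which has to
    be N c_N ([schro_hyp_trunc]): the functions
    (1-s)^al (1+s)^(N-al) (s / (1+s)^2)^i are mapped by the operator to
    combinations of two neighbours ([schro_hyp_term]), so that a truncated
    hypergeometric series solves the equation up to order N - 1 and its last
    term gives c_N as a product.  [schro_comp_sum] then follows by induction.

    The equation with z = -h is solved by (1-s)^al (1+s)^be, and formally G is
    phi_{-h}, because v_a = c_a / (a - h).  When h is a positive integer,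
    phi_{-h} has a vanishing denominator.  But the coefficients of
    both sides are polynomials in h for fixed y, so it is enough to compare
    them for h = -k with k a natural number, where nothing vanishes
    ([calG_coefE]).  Hence G(s) = (1-s)^(q/2) (1+s)^(p/2), and the square of
    G(r^2/4) is v(r). *)

(** * The ring of formal power series *)

Lemma exchange_triangle (V : zmodType) n (F : nat -> nat -> V) :
  \sum_(i < n.+1) \sum_(j < (n - i).+1) F i j =
  \sum_(j < n.+1) \sum_(i < (n - j).+1) F i j.
Proof.
have E (G : nat -> nat -> V) : \sum_(i < n.+1) \sum_(j < (n - i).+1) G i j =
    \sum_(i < n.+1) \sum_(j < n.+1 | (i + j <= n)%N) G i j.
  apply: eq_bigr => i _.
  rewrite (big_ord_widen n.+1 (G i)) ?ltnS ?leq_subr //.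
  by apply: eq_bigl => j; rewrite ltnS leq_subRL // -ltnS.
rewrite E (E (fun j i => F i j)) (exchange_big_dep xpredT) //=.
by apply: eq_bigr => j _; apply: eq_bigl => i; rewrite addnC.
Qed.

Section Ring.
Variable R : realType.
Implicit Types (a b c : fps R).

Definition fps_add a b : fps R := fun n => a n + b n.
Definition fps_opp a : fps R := fun n => - a n.
Definition fps_zero : fps R := fun=> 0.

HB.instance Definition _ := Choice.copy (fps R) (nat -> R).

Lemma fps_addA : associative fps_add.
Proof. by move=> a b c; apply/funext => n; rewrite /fps_add addrA. Qed.
Lemma fps_addC : commutative fps_add.
Proof. by move=> a b; apply/funext => n; rewrite /fps_add addrC. Qed.
Lemma fps_add0 : left_id fps_zero fps_add.
Proof. by move=> a; apply/funext => n; rewrite /fps_add add0r. Qed.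
Lemma fps_addN : left_inverse fps_zero fps_opp fps_add.
Proof. by move=> a; apply/funext => n; rewrite /fps_add addNr. Qed.

HB.instance Definition _ :=
  GRing.isZmodule.Build (fps R) fps_addA fps_addC fps_add0 fps_addN.

Lemma fps_mulA : associative (@fps_mul R).
Proof.
move=> a b c; apply/funext => n; rewrite /fps_mul.
transitivity (\sum_(i < n.+1) \sum_(j < (n - i).+1)
                a i * b (n - j - i)%N * c j).
  apply: eq_bigr => i _; rewrite mulr_sumr (reindex_inj rev_ord_inj) /=.
  apply: eq_bigr => j _; have := ltn_ord j; have := ltn_ord i.
  by move=> ? ?; rewrite mulrA; congr (_ * b _ * c _); lia.
rewrite (exchange_triangle n (fun i j => a i * b (n - j - i)%N * c j)).
rewrite [RHS](reindex_inj rev_ord_inj) /=; apply: eq_bigr => j _.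
by rewrite subSS mulr_suml subKn // -ltnS.
Qed.
Lemma fps_mulC : commutative (@fps_mul R).
Proof.
move=> a b; apply/funext => n; rewrite /fps_mul (reindex_inj rev_ord_inj) /=.
apply: eq_bigr => i _; rewrite subSS mulrC; congr (b _ * a _).
by rewrite subKn // -ltnS.
Qed.
Lemma fps_mul1 : left_id (fps_of_poly (1 : {poly R})) (@fps_mul R).
Proof.
move=> a; apply/funext => n; rewrite /fps_mul /fps_of_poly big_ord_recl /=.
rewrite coef1 mul1r subn0 big1 ?addr0 // => i _.
by rewrite coef1 mul0r.
Qed.
Lemma fps_mulDl : left_distributive (@fps_mul R) +%R.
Proof.
move=> a b c; apply/funext => n; rewrite /fps_mul -[RHS]big_split /=.
by apply: eq_bigr => i _; rewrite mulrDl.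
Qed.
Lemma fps_1_neq0 : fps_of_poly (1 : {poly R}) != 0.
Proof.
apply/eqP => /(congr1 (fun a : fps R => a 0%N)) /eqP.
by rewrite /fps_of_poly coef1 /= oner_eq0.
Qed.

HB.instance Definition _ := GRing.Zmodule_isComNzRing.Build (fps R)
  fps_mulA fps_mulC fps_mul1 fps_mulDl fps_1_neq0.

Lemma coef_fpsD a b n : (a + b) n = a n + b n. Proof. by []. Qed.
Lemma coef_fpsN a n : (- a) n = - a n. Proof. by []. Qed.
Lemma coef_fpsB a b n : (a - b) n = a n - b n. Proof. by []. Qed.
Lemma coef_fpsM a b n : (a * b) n = \sum_(i < n.+1) a i * b (n - i)%N.
Proof. by []. Qed.
Lemma coef_fps_sum (I : Type) (r : seq I) (P : pred I) (F : I -> fps R) n :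
  (\sum_(i <- r | P i) F i) n = \sum_(i <- r | P i) F i n.
Proof. exact: (big_morph (fun a : fps R => a n)). Qed.

Fact fps_of_poly_is_additive : zmod_morphism (@fps_of_poly R).
Proof. by move=> u v; apply/funext => n; rewrite /fps_of_poly coefB. Qed.
Fact fps_of_poly_is_multiplicative : monoid_morphism (@fps_of_poly R).
Proof. by split=> // u v; apply/funext => n; rewrite /fps_of_poly coefM. Qed.
HB.instance Definition _ := GRing.isZmodMorphism.Build {poly R} (fps R)
  (@fps_of_poly R) fps_of_poly_is_additive.
HB.instance Definition _ := GRing.isMonoidMorphism.Build {poly R} (fps R)
  (@fps_of_poly R) fps_of_poly_is_multiplicative.

Definition fpsC (x : R) : fps R := fps_of_poly x%:P.
Definition fpsX : fps R := fps_of_poly 'X.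

HB.instance Definition _ := GRing.RMorphism.copy fpsC (@fps_of_poly R \o polyC).

Lemma coef_fpsCM x a n : (fpsC x * a) n = x * a n.
Proof.
rewrite coef_fpsM big_ord_recl /= /fpsC /fps_of_poly coefC subn0 big1 ?addr0 //.
by move=> i _; rewrite coefC mul0r.
Qed.

Lemma coef_fpsXnM k a n :
  (fpsX ^+ k * a) n = if (n < k)%N then 0 else a (n - k)%N.
Proof.
rewrite /fpsX -rmorphXn /= coef_fpsM /fps_of_poly.
under eq_bigr do rewrite coefXn mulr_natl mulrb.
rewrite -big_mkcond /=; case: ltnP => [nk|kn].
  rewrite big_pred0 // => i; rewrite ltn_eqF //; apply: leq_ltn_trans nk.
  by rewrite -ltnS.
rewrite (big_pred1 (inord k)) => [|i] /=; first by rewrite inordK.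
by rewrite -val_eqE /= inordK.
Qed.

Lemma coef_fpsXM a n : (fpsX * a) n.+1 = a n.
Proof. by rewrite -[fpsX]expr1 coef_fpsXnM subn1. Qed.

(** * The Euler operator s d/ds *)

Definition theta a : fps R := fun n => n%:R * a n.

Lemma thetaD a b : theta (a + b) = theta a + theta b.
Proof. by apply/funext => n; rewrite /theta coef_fpsD mulrDr. Qed.
Lemma thetaM a b : theta (a * b) = theta a * b + a * theta b.
Proof.
apply/funext => n; rewrite coef_fpsD /theta !coef_fpsM mulr_sumr -big_split /=.
apply: eq_bigr => i _.
have {1}-> : n = (i + (n - i))%N by rewrite subnKC // -ltnS.
rewrite natrD; ring.
Qed.
Lemma thetaC x : theta (fpsC x) = 0.
Proof.
apply/funext => -[|n]; rewrite /theta ?mul0r //.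
by rewrite /fpsC /fps_of_poly coefC mulr0.
Qed.
Lemma thetaCM x a : theta (fpsC x * a) = fpsC x * theta a.
Proof. by rewrite thetaM thetaC mul0r add0r. Qed.
Lemma theta1 : theta 1 = 0.
Proof. by rewrite -(rmorph1 fpsC) thetaC. Qed.
Lemma thetaN a : theta (- a) = - theta a.
Proof. by apply/funext => n; rewrite /theta !coef_fpsN mulrN. Qed.
Lemma thetaX : theta fpsX = fpsX.
Proof.
apply/funext => n; rewrite /theta /fpsX /fps_of_poly coefX.
by case: n => [|[|n]] /=; rewrite ?mulr0 ?mul1r.
Qed.

(** A first-order equation theta a = eta a without constant term in eta
    determines each coefficient from the previous ones: n a_n involves only
    a_0, ..., a_{n-1}. *)
Lemma log_deriv_uniq (eta a b : fps R) : eta 0%N = 0 -> a 0%N = b 0%N ->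
  theta a = eta * a -> theta b = eta * b -> a = b.
Proof.
move=> eta0 ab0 Ea Eb; apply/funext => n; elim/ltn_ind: n => -[|n] IH //.
apply: (mulfI (x := n.+1%:R)); first by rewrite pnatr_eq0.
rewrite -[LHS]/(theta a n.+1) -[RHS]/(theta b n.+1) Ea Eb !coef_fpsM.
rewrite big_ord_recl [RHS]big_ord_recl /= eta0 !mul0r !add0r.
by apply: eq_bigr => i _; rewrite IH // /bump /= subSS ltnS leq_subr.
Qed.

Lemma theta_logM a b eta mu : theta a = eta * a -> theta b = mu * b ->
  theta (a * b) = (eta + mu) * (a * b).
Proof. by move=> Ea Eb; rewrite thetaM Ea Eb; ring. Qed.

Lemma theta_logX a eta k : theta a = eta * a ->
  theta (a ^+ k) = (eta *+ k) * a ^+ k.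
Proof.
move=> Ea; elim: k => [|k IH]; first by rewrite expr0 theta1 mulr0n mul0r.
by rewrite exprS mulrS; apply: theta_logM.
Qed.

(** * The series (1 - s)^al (1 + s)^be *)

(** The inverse of 1 + e s ([mul1X_geom]). *)
Definition geom (e : R) : fps R := fun n => (- e) ^+ n.

Lemma mul1X_geom e : (1 + fpsC e * fpsX) * geom e = 1.
Proof.
apply/funext => n; rewrite mulrDl mul1r -mulrA coef_fpsD coef_fpsCM.
rewrite -[fpsX]expr1 coef_fpsXnM.
have -> : (1 : fps R) n = (n == 0%N)%:R by rewrite -coef1.
case: n => [|n] /=; first by rewrite mulr0 addr0 /geom expr0.
by rewrite subn1 /= /geom exprS; ring.
Qed.

Lemma theta_geom e : theta (geom e) = geom e ^+ 2 - geom e.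
Proof.
have E := mul1X_geom e.
have := congr1 theta E.
rewrite theta1 thetaM thetaD theta1 add0r thetaCM thetaX => F.
have : geom e * (fpsC e * fpsX * geom e
    + (1 + fpsC e * fpsX) * theta (geom e)) = 0.
  by rewrite F mulr0.
have -> : geom e * (fpsC e * fpsX * geom e
    + (1 + fpsC e * fpsX) * theta (geom e)) =
    (1 + fpsC e * fpsX) * geom e * (geom e + theta (geom e)) - geom e ^+ 2.
  ring.
by rewrite E mul1r => /eqP; rewrite subr_eq0 => /eqP <-; ring.
Qed.

(** Partial fractions: 2 / (1 - s^2) = 1 / (1 + s) + 1 / (1 - s). It is the
    only relation between [geom 1] and [geom (-1)] in the differential
    identities below. *)
Lemma geom_cross : geom 1 * geom (-1) *+ 2 = geom 1 + geom (-1).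
Proof.
have E := mul1X_geom 1; have F := mul1X_geom (-1).
rewrite !rmorphN !rmorph1 in E F.
have -> : geom 1 * geom (-1) *+ 2 =
   ((1 + 1 * fpsX) * geom 1) * geom (-1) +
   ((1 + -1 * fpsX) * geom (-1)) * geom 1 by ring.
by rewrite E F; ring.
Qed.

(** The binomial series of (1 + e s)^g; its coefficients are visibly
    polynomial in g, which the continuation in h relies on. *)
Definition binser (e g : R) : fps R :=
  fun n => e ^+ n * (\prod_(k < n) (g - k%:R)) / n`!%:R.

Lemma binser0 e g : binser e g 0%N = 1.
Proof. by rewrite /binser big_ord0 expr0 fact0 !mul1r invr1. Qed.

Lemma theta_binser e g :
  theta (binser e g) = fpsC g * (1 - geom e) * binser e g.
Proof.
have E : (1 + fpsC e * fpsX) * theta (binser e g) =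
         fpsC (g * e) * (fpsX * binser e g).
  apply/funext => n; rewrite mulrDl mul1r -mulrA coef_fpsD !coef_fpsCM.
  case: n => [|n].
    by rewrite /theta mul0r -[fpsX]expr1 !coef_fpsXnM /= !mulr0 add0r.
  rewrite !coef_fpsXM /theta /binser big_ord_recr /= factS natrM exprS.
  have n1 : n.+1%:R != 0 :> R by rewrite pnatr_eq0.
  have nf : n`!%:R != 0 :> R by rewrite pnatr_eq0 -lt0n fact_gt0.
  by field; rewrite nf nat1r.
transitivity ((1 + fpsC e * fpsX) * geom e * theta (binser e g)).
  by rewrite mul1X_geom mul1r.
transitivity (fpsC g * ((1 + fpsC e * fpsX) * geom e - geom e) * binser e g).
  by rewrite mulrAC E rmorphM /=; ring.
by rewrite mul1X_geom.
Qed.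

Definition binser2 (al be : R) : fps R := binser (-1) al * binser 1 be.

Lemma binser20 al be : binser2 al be 0%N = 1.
Proof. by rewrite /binser2 coef_fpsM big_ord1 !binser0 mulr1. Qed.

Lemma theta_binser2 al be : theta (binser2 al be) =
  (fpsC al * (1 - geom (-1)) + fpsC be * (1 - geom 1)) * binser2 al be.
Proof. by apply: theta_logM; rewrite theta_binser. Qed.

End Ring.

(** * The Schroedinger operator *)

Section ODE.
Variables (R : realType) (h y : R).

Definition expo_minus : R := (h + y) / 2.
Definition expo_plus : R := (h - y) / 2.
Local Notation al := expo_minus.
Local Notation be := expo_plus.

(** al (al - 1) s / (1 - s)^2 - be (be - 1) s / (1 + s)^2, written in the two
    geometric series because theta maps each of them to a polynomial in
    itself. *)
Definition potential : fps R :=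
  fpsC (al * (al - 1)) * (geom (-1) ^+ 2 - geom (-1))
  - fpsC (be * (be - 1)) * (geom 1 - geom 1 ^+ 2).

(** (1 - s)^al (1 + s)^(nu - al) (s / (1 + s)^2)^i: up to constants and a
    common factor, the terms of a hypergeometric series in 4 s / (1 + s)^2. *)
Definition hyp_term (nu : R) (i : nat) : fps R :=
  binser2 al (nu - al) * (geom 1 - geom 1 ^+ 2) ^+ i.

Definition schro (nu : R) (f : fps R) : fps R :=
  theta (theta f) - fpsC nu * theta f - potential * f.

(** Both theta and multiplication by [potential] multiply [hyp_term] by
    polynomials in the two geometric series, so this is a polynomial identity
    modulo [geom_cross]. The two coefficients are those of the hypergeometric
    recursion with parameters (h - nu) / 2, (y + 1 - nu) / 2 and 1 - nu. *)
Lemma schro_hyp_term nu i : schro nu (hyp_term nu i) =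
  fpsC (i%:R * (i%:R - nu)) * hyp_term nu i
  - fpsC ((h - nu + 2 * i%:R) * (y + 1 - nu + 2 * i%:R)) * hyp_term nu i.+1.
Proof.
have Eh : h = al + be by rewrite /al /be; field.
have Ey : y = al - be by rewrite /al /be; field.
rewrite {1}Eh {1}Ey /schro /potential /hyp_term (exprS _ i).
move: al be => a b.
pose sg : fps R := geom 1; pose ta : fps R := geom (-1).
rewrite -/sg -/ta.
have Esg : theta sg = sg ^+ 2 - sg := theta_geom _.
have Eta : theta ta = ta ^+ 2 - ta := theta_geom _.
have Ecr : sg * ta *+ 2 - (sg + ta) = 0.
  by apply/eqP; rewrite subr_eq0 /sg /ta geom_cross.
have EX : theta (sg - sg ^+ 2) = (sg *+ 2 - 1) * (sg - sg ^+ 2).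
  rewrite thetaD thetaN expr2 thetaM Esg; ring.
set X := sg - sg ^+ 2 in EX *.
set H := binser2 a (nu - a).
pose eta := fpsC a * (1 - ta) + fpsC (nu - a) * (1 - sg) + (sg *+ 2 - 1) *+ i.
have ET : theta (H * X ^+ i) = eta * (H * X ^+ i).
  by apply: theta_logM (theta_logX _ EX); rewrite theta_binser2.
have Eeta : theta eta = - fpsC a * (ta ^+ 2 - ta)
   - fpsC (nu - a) * (sg ^+ 2 - sg) + (sg ^+ 2 - sg) *+ i *+ 2.
  have Ei : (sg *+ 2 - 1) *+ i = fpsC (i%:R) * (fpsC 2 * sg - 1).
    by rewrite !rmorph_nat -mulr_natl; ring.
  rewrite /eta Ei !thetaD !thetaCM !thetaD !thetaN thetaCM theta1 Esg Eta.
  rewrite !rmorph_nat; ring.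
set T := H * X ^+ i in ET *.
have -> : H * (X * X ^+ i) = X * T by rewrite /T; ring.
rewrite ET thetaM ET Eeta.
rewrite /eta /X !(rmorphM, rmorphD, rmorphN, rmorph1, rmorph_nat) /=.
apply/eqP; rewrite -subr_eq0; apply/eqP.
(* The cofactor collects the mixed terms of eta ^+ 2, the only products of sg
   and ta. *)
transitivity (T * (fpsC a * (fpsC nu - fpsC a - i%:R *+ 2)) *
  (sg * ta *+ 2 - (sg + ta))); last by rewrite Ecr mulr0.
ring.
Qed.
End ODE.

(** * Sums over compositions *)

(** Compositions sorted by their first part. *)
Lemma perm_compositionsS n : perm_eq (compositions n.+1)
  [seq l.+1 :: J | l <- iota 0 n.+1, J <- compositions (n - l)].
Proof.
apply: uniq_perm; first exact: uniq_compositions.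
  apply: allpairs_uniq_dep; first exact: iota_uniq.
    by move=> l _; apply: uniq_compositions.
  by move=> [l J] [m K] _ _ /= [-> ->].
move=> s; rewrite mem_compositions; apply/andP/allpairsPdep => [[]|].
  case: s => [|[|l] J] //= Jp /eqP sJ.
  exists l, J; split=> //.
    by rewrite -[_ :: _]/(iota 0 n.+1) mem_iota; lia.
  by rewrite mem_compositions Jp /=; apply/eqP; lia.
move=> [l [J [+ + ->]]]; rewrite mem_iota mem_compositions /= => lt_l.
by case/andP=> -> /eqP ->; split=> //; apply/eqP; lia.
Qed.

Section Scattering.
Variables (R : realType) (h y : R).

(** P_{2N}(1) ([gjms_cst]). *)
Definition gjms_one (N : nat) : R := (-1) ^+ N *
  \prod_(k < N) ((h - N%:R + 2 * k%:R) * (y + 1 - N%:R + 2 * k%:R)).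

(** The residue of phi_z ([comp_sum]) at z = -N is this coefficient times s^N
    phi_N. *)
Definition res_coef (N : nat) : R := - gjms_one N / (N`!%:R * N.-1`!%:R).

Fixpoint comp_weight (z : R) (J : seq nat) : R :=
  if J is b :: J' then res_coef b / (z + b%:R) * comp_weight b%:R J' else 1.

(** The series phi_z: its m-th coefficient sums, over the compositions of m,
    the products of [res_coef] over the parts, divided by the sums of adjacent
    entries of z, J_1, ..., J_r. *)
Definition comp_sum (z : R) : fps R :=
  fun m => \sum_(J <- compositions m) comp_weight z J.

Lemma comp_sum0 z : comp_sum z 0%N = 1.
Proof. by rewrite /comp_sum big_seq1. Qed.

Lemma comp_sumS z n : comp_sum z n.+1 =
  \sum_(l < n.+1) res_coef l.+1 / (z + l.+1%:R) * comp_sum l.+1%:R (n - l)%N.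
Proof.
rewrite /comp_sum (perm_big _ (perm_compositionsS n)) big_allpairs_dep.
rewrite -[RHS](big_mkord xpredT (fun l => res_coef l.+1 / (z + l.+1%:R) *
  \sum_(J <- compositions (n - l)) comp_weight l.+1%:R J)).
rewrite /index_iota subn0.
by apply: eq_bigr => l _; rewrite mulr_sumr.
Qed.

Local Notation V := (potential h y).

Lemma potential0 : V 0%N = 0.
Proof.
rewrite /potential coef_fpsB !coef_fpsCM !coef_fpsB !expr2 !coef_fpsM !big_ord1.
by rewrite /geom !expr0; ring.
Qed.

(** In the convolution of the potential with the recursion [comp_sumS], the
    sums over the order of V and over the first part can be exchanged. *)
Lemma potential_comp_sum z n : (V * comp_sum z) n.+1 = V n.+1 +
  \sum_(l < n.+1) res_coef l.+1 / (z + l.+1%:R)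
    * (V * comp_sum l.+1%:R) (n - l)%N.
Proof.
rewrite coef_fpsM big_ord_recr /= subnn comp_sum0 mulr1 addrC; congr (_ + _).
transitivity (\sum_(i < n.+1) \sum_(l < (n - i).+1)
   res_coef l.+1 / (z + l.+1%:R) * (V i * comp_sum l.+1%:R (n - l - i)%N)).
  apply: eq_bigr => i _; rewrite subSn; last by rewrite -ltnS.
  rewrite comp_sumS mulr_sumr; apply: eq_bigr => l _.
  by rewrite mulrCA subnAC.
rewrite (exchange_triangle n (fun i l => res_coef l.+1 / (z + l.+1%:R) *
  (V i * comp_sum l.+1%:R (n - l - i)%N))).
by apply: eq_bigr => l _; rewrite coef_fpsM mulr_sumr.
Qed.

Lemma coef_schro nu (f : fps R) n :
  schro h y nu f n = n%:R * (n%:R - nu) * f n - (V * f) n.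
Proof. rewrite /schro !coef_fpsB coef_fpsCM /theta; ring. Qed.

Lemma potential_eq (a b : fps R) n : (forall j, (j < n)%N -> a j = b j) ->
  (V * a) n = (V * b) n.
Proof.
move=> ab; rewrite !coef_fpsM big_ord_recl [RHS]big_ord_recl potential0 !mul0r.
congr (_ + _); apply: eq_bigr => i _; rewrite ab // lift0.
by have := ltn_ord i; lia.
Qed.

Lemma schro_uniq nu (a b : fps R) N : a 0%N = b 0%N ->
  (forall j, (0 < j < N)%N -> j%:R - nu != 0) ->
  (forall j, (j < N)%N -> schro h y nu a j = 0) ->
  (forall j, (j < N)%N -> schro h y nu b j = 0) ->
  forall j, (j < N)%N -> a j = b j.
Proof.
move=> ab0 nz sa sb j; elim/ltn_ind: j => -[|j] IH jN //.
have ab := potential_eq (n := j.+1) (fun k kj => IH k kj (ltn_trans kj jN)).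
move: (sa _ jN) (sb _ jN); rewrite !coef_schro ab => /eqP + /eqP.
rewrite !subr_eq0 => /eqP <- /eqP /mulfI -> //.
by rewrite mulf_neq0 ?pnatr_eq0 ?nz.
Qed.

(** * The obstruction at z = -N *)

(** Coefficients of the hypergeometric series adapted to z = -N; the
    denominator vanishes from i = N on, hence the truncation in [hyp_trunc]. *)
Definition hyp_coef (N i : nat) : R := \prod_(k < i)
  ((h - N%:R + 2 * k%:R) * (y + 1 - N%:R + 2 * k%:R)
   / (k.+1%:R * (k.+1%:R - N%:R))).

Definition hyp_trunc (N : nat) : fps R :=
  \sum_(i < N) fpsC (hyp_coef N i) * hyp_term h y N%:R i.

(** s / (1 + s)^2 has order one, so [hyp_term i] is s^i + O(s^(i+1)). *)
Lemma coef_hyp_term nu i n : (n <= i)%N -> hyp_term h y nu i n = (n == i)%:R.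
Proof.
move=> ni; rewrite /hyp_term.
have -> : geom 1 - geom 1 ^+ 2 = fpsX R * geom 1 ^+ 2.
  have E := mul1X_geom (1 : R); rewrite rmorph1 mul1r in E.
  transitivity ((1 + fpsX R) * geom 1 * geom 1 - geom 1 ^+ 2); last by ring.
  by rewrite E mul1r.
rewrite exprMn mulrCA coef_fpsXnM; case: ltngtP ni => // -> _.
have H0 (a b : fps R) : (a * b) 0%N = a 0%N * b 0%N.
  by rewrite coef_fpsM big_ord1.
have G0 : (geom 1 : fps R) 0%N = 1 by rewrite /geom expr0.
have Gk k : ((geom 1 : fps R) ^+ k) 0%N = 1.
  elim: k => [|k IH]; last by rewrite exprS H0 G0 IH mulr1.
  by rewrite expr0 -[LHS]/((1 : {poly R})`_0) coef1.
by rewrite subnn H0 binser20 -exprM Gk mulr1.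
Qed.

Lemma schroD nu f g : schro h y nu (f + g) = schro h y nu f + schro h y nu g.
Proof. by rewrite /schro !thetaD; ring. Qed.
Lemma schroC nu c f : schro h y nu (fpsC c * f) = fpsC c * schro h y nu f.
Proof. by rewrite /schro !thetaCM; ring. Qed.

(** The recursion for [hyp_coef] makes the images of successive terms
    telescope, and only the contribution of the last one to the next remains.
    Its coefficient is the full product of the linear factors of P_{2N}(1),
    divided by prod_{0 < k < N} k (k - N) = (-1)^(N-1) (N-1)!^2. *)
Lemma schro_hyp_trunc n : schro h y n.+1%:R (hyp_trunc n.+1) =
  - fpsC (n.+1%:R * res_coef n.+1) * hyp_term h y n.+1%:R n.+1.
Proof.
set N := n.+1.
pose A i : R := (h - N%:R + 2 * i%:R) * (y + 1 - N%:R + 2 * i%:R).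
have H i : (i <= n)%N ->
   schro h y N%:R (\sum_(k < i.+1) fpsC (hyp_coef N k) * hyp_term h y N%:R k) =
   - fpsC (hyp_coef N i * A i) * hyp_term h y N%:R i.+1.
  elim: i => [|i IH] iN.
    by rewrite big_ord1 schroC schro_hyp_term mul0r rmorph0 rmorphM /A /=; ring.
  rewrite big_ord_recr /= schroD IH 1?ltnW // schroC schro_hyp_term -/(A i.+1).
  have -> : hyp_coef N i * A i = hyp_coef N i.+1 * (i.+1%:R * (i.+1%:R - N%:R)).
    rewrite /hyp_coef big_ord_recr /= -/(A i) -mulrA divfK //.
    by rewrite mulf_neq0 ?pnatr_eq0 // subr_eq0 eqr_nat; lia.
  by rewrite !rmorphM /=; ring.
rewrite /hyp_trunc H //; congr (- fpsC _ * _).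
rewrite /hyp_coef prodf_div.
have -> : \prod_(k < n) (k.+1%:R * (k.+1%:R - N%:R)) =
   (-1) ^+ n * n`!%:R ^+ 2 :> R.
  rewrite big_split /=.
  have F : \prod_(k < n) k.+1%:R = n`!%:R :> R.
    by rewrite -natr_prod fact_prod big_add1 /= big_mkord.
  rewrite F (reindex_inj rev_ord_inj) /=.
  have -> : \prod_(k < n) ((n - k.+1).+1%:R - N%:R) = (-1) ^+ n * n`!%:R :> R.
    rewrite -F -[X in (-1) ^+ X](card_ord n) -prodrN; apply: eq_bigr => k _.
    rewrite -opprB -natrB; last by rewrite /N; have := ltn_ord k; lia.
    by congr (- _%:R); rewrite /N; have := ltn_ord k; lia.
  ring.
rewrite /res_coef /gjms_one big_ord_recr /= -/(A n) factS natrM (exprS (-1) n).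
have -> : \prod_(i < n) ((h - N%:R + 2 * i%:R) * (y + 1 - N%:R + 2 * i%:R)) =
   \prod_(i < n) A i by [].
have nf : n`!%:R != 0 :> R by rewrite pnatr_eq0 -lt0n fact_gt0.
have nn : n.+1%:R != 0 :> R by rewrite pnatr_eq0.
by rewrite invfM invr_sign /N; field; rewrite nf nat1r.
Qed.

Lemma hyp_trunc0 n : hyp_trunc n.+1 0%N = 1.
Proof.
rewrite /hyp_trunc big_ord_recl coef_fpsD coef_fps_sum big1 => [|i _].
  by rewrite coef_fpsCM /hyp_coef big_ord0 coef_hyp_term // mulr1 addr0.
by rewrite coef_fpsCM coef_hyp_term // mulr0.
Qed.

(** By induction on the order N. At z = -N the equation in lower orders
    identifies phi_z with [hyp_trunc], whence N c_N as the coefficient of V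
    phi_{-N} ([obstr]). Expanding V phi_{-N} with [potential_comp_sum] turns
    this into V_N = N sum_l c_l (phi_l)_{N-l} ([star]), a relation free of z,
    which is what the N-th order of the equation at an arbitrary z amounts to
    because (N + z) / (z + l) = 1 + (N - l) / (z + l). *)
Lemma schro_comp_sum N z : (forall l, (l < N)%N -> z + l.+1%:R != 0) ->
  schro h y (- z) (comp_sum z) N = 0.
Proof.
elim/ltn_ind: N z => -[|n] IH z nz.
  by rewrite coef_schro mul0r coef_fpsM big_ord1 potential0 mul0r subrr.
have IHnat l m : (m <= n)%N ->
    (V * comp_sum l%:R) m = m%:R * (m + l)%:R * comp_sum l%:R m.
  move=> mn; have := IH m mn l%:R; rewrite coef_schro opprK -natrD => sol.
  apply/esym/eqP; rewrite -subr_eq0 sol // => k _.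
  by rewrite -natrD pnatr_eq0; lia.
have eq_low j : (j < n.+1)%N -> comp_sum (- n.+1%:R) j = hyp_trunc n.+1 j.
  apply: (@schro_uniq n.+1%:R); first by rewrite comp_sum0 hyp_trunc0.
  - by move=> k kn; rewrite subr_eq0 eqr_nat; lia.
  - move=> k kn; have := IH k kn (- n.+1%:R); rewrite opprK; apply=> l lk.
    by rewrite addrC subr_eq0 eqr_nat; lia.
  move=> k kn; rewrite schro_hyp_trunc -rmorphN /= coef_fpsCM.
  by rewrite coef_hyp_term ?ltn_eqF ?mulr0 // ltnW.
have obstr : (V * comp_sum (- n.+1%:R)) n.+1 = n.+1%:R * res_coef n.+1.
  rewrite (potential_eq eq_low).
  have := congr1 (fun f : fps R => f n.+1) (schro_hyp_trunc n).
  rewrite /= coef_schro subrr mulr0 mul0r sub0r -rmorphN /= coef_fpsCM.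
  by rewrite coef_hyp_term // eqxx mulr1 => /oppr_inj.
have star : V n.+1 = n.+1%:R *
    \sum_(l < n.+1) res_coef l.+1 * comp_sum l.+1%:R (n - l)%N.
  move: obstr; rewrite potential_comp_sum => /(canRL (addrK _)) ->.
  rewrite !big_ord_recr /= subnn comp_sum0 coef_fpsM big_ord1 potential0.
  rewrite mul0r mulr0 addr0 mulr1 mulrDr addrC; congr (_ + _).
  rewrite mulr_sumr -sumrN; apply: eq_bigr => l _; rewrite IHnat ?leq_subr //.
  have -> : (n - l + l.+1)%N = n.+1 by have := ltn_ord l; lia.
  have -> : - n.+1%:R + l.+1%:R = - (n - l)%:R :> R.
    by rewrite -subSS natrB ?opprB 1?addrC // ltnW // ltnS.
  have nl : (n - l)%:R != 0 :> R by rewrite pnatr_eq0; have := ltn_ord l; lia.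
  by field.
rewrite coef_schro opprK potential_comp_sum star comp_sumS !mulr_sumr.
rewrite -big_split.
apply/eqP; rewrite subr_eq0; apply/eqP; apply: eq_bigr => l _ /=.
rewrite IHnat ?leq_subr //.
have ln : (l <= n)%N by rewrite -ltnS.
have -> : (n - l + l.+1)%N = n.+1 by lia.
have -> : (n - l)%:R = n.+1%:R - l.+1%:R :> R by rewrite -natrB ?subSS.
by field; rewrite nat1r nz.
Qed.

(** (1-s)^al (1+s)^be is [hyp_term] for nu = h and i = 0, where both
    coefficients in [schro_hyp_term] vanish. *)
Lemma comp_sum_binomial k n : h = - k%:R ->
  comp_sum k%:R n = binser2 (expo_minus h y) (expo_plus h y) n.
Proof.
move=> hk; apply: (@schro_uniq (- k%:R) _ _ n.+1) => //.
- by rewrite comp_sum0 binser20.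
- by move=> j ?; rewrite opprK -natrD pnatr_eq0; lia.
- by move=> j _; apply: schro_comp_sum => l _; rewrite -natrD pnatr_eq0; lia.
move=> j _.
have := schro_hyp_term h y h 0.
rewrite mul0r rmorph0 mul0r mulr0 addr0 subrr mul0r rmorph0 mul0r subrr.
have -> : hyp_term h y h 0 = binser2 (expo_minus h y) (expo_plus h y).
  rewrite /hyp_term expr0 mulr1; congr binser2.
  by rewrite /expo_minus /expo_plus; field.
by rewrite hk => ->.
Qed.

(** * Continuation in h *)

(** Q_{2N} as a function of h and y. *)
Definition Qval (N : nat) : R :=
  (\prod_(1 <= j < N) (h + N%:R - 2 * j%:R)) *
  \prod_(0 <= j < N) (y - N%:R + 1 + 2 * j%:R).

(** By [Qres_res_coef] this is c_a / (a - h), extended to h = a. *)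
Definition Qres (a : nat) : R := (-1) ^+ a * Qval a / (a`!%:R * a.-1`!%:R).

Lemma gjms_one_Qval N :
  gjms_one N.+1 = (-1) ^+ N.+1 * (h - N.+1%:R) * Qval N.+1.
Proof.
rewrite /gjms_one /Qval big_split /= -!mulrA; congr (_ * _).
rewrite big_ord_recl /= mulr0 addr0 -mulrA; congr (_ * (_ * _)); last first.
  by rewrite big_mkord; apply: eq_bigr => j _; ring.
rewrite big_add1 big_mkord (reindex_inj rev_ord_inj) /=; apply: eq_bigr => j _.
rewrite /bump /= add1n.
have -> : (N - j.+1).+1%:R = N.+1%:R - j.+1%:R :> R.
  by rewrite -natrB; [congr (_%:R)|]; have := ltn_ord j; lia.
ring.
Qed.

Lemma Qres_res_coef N : (N.+1%:R - h) * Qres N.+1 = res_coef N.+1.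
Proof. by rewrite /Qres /res_coef gjms_one_Qval; ring. Qed.

(** The N-th coefficient of G for N > 0, as a function of h and y ([calGE]). *)
Definition calG_coef (N : nat) : R :=
  \sum_(a < N) Qres a.+1 * comp_sum a.+1%:R (N - a.+1)%N.

Lemma calG_coef_nat k n : h = - k%:R ->
  calG_coef n.+1 = binser2 (expo_minus h y) (expo_plus h y) n.+1.
Proof.
move=> hk; rewrite -(comp_sum_binomial _ hk) comp_sumS.
apply: eq_bigr => a _; rewrite subSS -Qres_res_coef hk opprK; congr (_ * _).
by rewrite [k%:R + _]addrC mulrAC divff ?mul1r // -natrD pnatr_eq0; lia.
Qed.

End Scattering.

Section PolyFun.
Variable R : realType.
Implicit Types f g : R -> R.

Definition polyfun f := exists P : {poly R}, forall x, f x = P.[x].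

Lemma polyfun_cst c : polyfun (fun=> c).
Proof. by exists c%:P => x; rewrite hornerC. Qed.
Lemma polyfun_id : polyfun id.
Proof. by exists 'X => x; rewrite hornerX. Qed.
Lemma polyfunD f g : polyfun f -> polyfun g -> polyfun (fun x => f x + g x).
Proof. by move=> [P fP] [Q gQ]; exists (P + Q) => x; rewrite fP gQ hornerD. Qed.
Lemma polyfunM f g : polyfun f -> polyfun g -> polyfun (fun x => f x * g x).
Proof. by move=> [P fP] [Q gQ]; exists (P * Q) => x; rewrite fP gQ hornerM. Qed.
Lemma polyfunN f : polyfun f -> polyfun (fun x => - f x).
Proof. by move=> [P fP]; exists (- P) => x; rewrite fP hornerN. Qed.
Lemma polyfun_sum (I : Type) (r : seq I) (F : I -> R -> R) :
  (forall i, polyfun (F i)) -> polyfun (fun x => \sum_(i <- r) F i x).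
Proof.
move=> FP; elim: r => [|i r IH].
  by have [P PE] := polyfun_cst 0; exists P => x; rewrite big_nil -PE.
have [P PE] := polyfunD (FP i) IH.
by exists P => x; rewrite big_cons PE.
Qed.
Lemma polyfun_prod (I : Type) (r : seq I) (F : I -> R -> R) :
  (forall i, polyfun (F i)) -> polyfun (fun x => \prod_(i <- r) F i x).
Proof.
move=> FP; elim: r => [|i r IH].
  by have [P PE] := polyfun_cst 1; exists P => x; rewrite big_nil -PE.
have [P PE] := polyfunM (FP i) IH.
by exists P => x; rewrite big_cons PE.
Qed.

(** A polynomial with infinitely many zeros vanishes. *)
Lemma polyfun_eq f g : polyfun f -> polyfun g ->
  (forall k : nat, f (- k%:R) = g (- k%:R)) -> f =1 g.
Proof.
move=> [P fP] [Q gQ] fg x; rewrite fP gQ; congr (_.[_]); apply/eqP.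
rewrite -subr_eq0; apply/negPn/negP => nz.
pose s : seq R := [seq - k%:R | k <- iota 0 (size (P - Q))].
suff: (size s < size (P - Q)%R)%N by rewrite size_map size_iota ltnn.
apply: max_poly_roots => //.
  apply/allP => _ /mapP[k _ ->].
  by rewrite /root hornerD hornerN -fP -gQ fg subrr.
rewrite map_inj_uniq ?iota_uniq // => i j /oppr_inj /eqP.
by rewrite eqr_nat => /eqP.
Qed.
End PolyFun.

Section Continuation.
Variables (R : realType) (y : R).

Lemma polyfun_gjms_one N : polyfun (fun h => gjms_one h y N).
Proof.
apply: polyfunM; first exact: polyfun_cst.
apply: polyfun_prod => i; apply: polyfunM; last exact: polyfun_cst.
by do 2 (apply: polyfunD; last exact: polyfun_cst); apply: polyfun_id.
Qed.

Lemma polyfun_res_coef N : polyfun (fun h => res_coef h y N).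
Proof.
by apply: polyfunM (polyfun_cst _); apply: polyfunN; apply: polyfun_gjms_one.
Qed.

Lemma polyfun_comp_sum z n : polyfun (fun h => comp_sum h y z n).
Proof.
apply: polyfun_sum => J; elim: J z => [|b J IH] z /=; first exact: polyfun_cst.
by do 2 apply: polyfunM => //; [exact: polyfun_res_coef | exact: polyfun_cst].
Qed.

Lemma polyfun_calG_coef n : polyfun (fun h => calG_coef h y n).
Proof.
apply: polyfun_sum => a; apply: polyfunM; last exact: polyfun_comp_sum.
apply: polyfunM (polyfun_cst _); apply: polyfunM; first exact: polyfun_cst.
apply: polyfunM (polyfun_cst _); apply: polyfun_prod => j.
by do 2 (apply: polyfunD; last exact: polyfun_cst); apply: polyfun_id.
Qed.

Lemma polyfun_binser e (g : R -> R) n : polyfun g ->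
  polyfun (fun h => binser e (g h) n).
Proof.
move=> gP; apply: polyfunM (polyfun_cst _); apply: polyfunM (polyfun_cst _) _.
by apply: polyfun_prod => k; apply: polyfunD gP (polyfun_cst _).
Qed.

Lemma polyfun_binser2 n :
  polyfun (fun h => binser2 (expo_minus h y) (expo_plus h y) n).
Proof.
apply: polyfun_sum => i; apply: polyfunM; apply: polyfun_binser;
  apply: polyfunM (polyfun_cst _); apply: polyfunD (polyfun_cst _);
  exact: polyfun_id.
Qed.

Lemma calG_coefE h n : calG_coef h y n.+1 =
  binser2 (expo_minus h y) (expo_plus h y) n.+1.
Proof.
apply: (polyfun_eq (polyfun_calG_coef n.+1) (polyfun_binser2 n.+1)) => k.
exact: calG_coef_nat.
Qed.

End Continuation.

(** * Substitution into power series *)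

Section Subst.
Variable R : realType.
Implicit Types (a b : fps R) (P Q u : {poly R}).

(** X divides u, hence X^j divides u^j. *)
Lemma coef_exp_lt u j n : u`_0 = 0 -> (n < j)%N -> (u ^+ j)`_n = 0.
Proof.
move=> u0 nj.
have -> : u = drop_poly 1 u * 'X.
  rewrite -{1}(poly_take_drop 1 u) expr1 -[RHS]add0r; congr (_ + _).
  by apply/polyP => -[|i]; rewrite coef_take_poly coef0 //= u0.
by rewrite exprMn coefMXn nj.
Qed.

(** Terms beyond order n do not contribute, so substitution into a series can
    be computed by composition with any polynomial that agrees with it up to
    order n. *)
Lemma fps_substE a u P n : u`_0 = 0 -> (forall j, (j <= n)%N -> P`_j = a j) ->
  fps_subst a u n = (P \Po u)`_n.
Proof.
move=> u0 Pa; rewrite comp_polyE coef_sum.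
under [RHS]eq_bigr do rewrite coefZ.
rewrite /fps_subst.
transitivity (\sum_(j < maxn n.+1 (size P)) P`_j * (u ^+ j)`_n).
  rewrite (big_ord_widen _ (fun j => a j * (u ^+ j)`_n) (leq_maxl _ (size P))).
  rewrite big_mkcond /=; apply: eq_bigr => j _.
  rewrite ltnS; case: leqP => jn; first by rewrite Pa.
  by rewrite coef_exp_lt // mulr0.
rewrite [RHS](big_ord_widen _ (fun j => P`_j * (u ^+ j)`_n) (leq_maxr n.+1 _)).
rewrite [RHS]big_mkcond /=; apply: eq_bigr => j _.
by case: ltnP => // jn; rewrite nth_default // mul0r.
Qed.

Lemma fps_substM a b u : u`_0 = 0 ->
  fps_subst (a * b) u = fps_subst a u * fps_subst b u.
Proof.
move=> u0; apply/funext => n.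
pose tr (c : fps R) := \poly_(j < n.+1) c j.
have trE c j : (j <= n)%N -> (tr c)`_j = c j.
  by move=> jn; rewrite coef_poly ltnS jn.
rewrite (@fps_substE _ _ (tr a * tr b)) // => [|j jn].
  rewrite comp_polyM coefM coef_fpsM; apply: eq_bigr => i _.
  have ilen : (i <= n)%N by rewrite -ltnS.
  rewrite (@fps_substE a _ (tr a)) // => [|k ki]; last exact/trE/(leq_trans ki).
  rewrite (@fps_substE b _ (tr b)) // => k kn.
  by apply: trE; apply: leq_trans kn _; apply: leq_subr.
rewrite coefM coef_fpsM; apply: eq_bigr => i _; rewrite !trE //.
  by apply: leq_trans jn; apply: leq_subr.
by apply: leq_trans jn; rewrite -ltnS.
Qed.

Lemma fps_subst_poly P u : u`_0 = 0 ->
  fps_subst (fps_of_poly P) u = fps_of_poly (P \Po u).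
Proof. by move=> u0; apply/funext => n; apply: fps_substE. Qed.
End Subst.

(** Both sides have logarithmic derivative -m s / (1 - s) + n s / (1 + s). *)
Lemma binser2_nat (R : realType) (m n : nat) :
  binser2 (m%:R : R) n%:R = fps_of_poly ((1 - 'X) ^+ m * (1 + 'X) ^+ n).
Proof.
have lin (e : R) : theta (1 + fpsC e * fpsX R) =
    (1 - geom e) * (1 + fpsC e * fpsX R).
  rewrite thetaD theta1 thetaCM thetaX mulrBl [geom e * _]mulrC mul1X_geom.
  by ring.
pose eta : fps R := fpsC m%:R * (1 - geom (-1)) + fpsC n%:R * (1 - geom 1).
apply: (@log_deriv_uniq _ eta).
- rewrite /eta coef_fpsD !coef_fpsCM !coef_fpsB.
  rewrite -[(1 : fps R) 0%N]/((1 : {poly R})`_0) coef1 /geom !expr0.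
  by rewrite subrr !mulr0 addr0.
- rewrite binser20 /fps_of_poly -horner_coef0 hornerM !horner_exp !hornerE.
  by rewrite subr0 !expr1n mulr1.
- exact: theta_binser2.
rewrite rmorphM !rmorphXn rmorphB rmorphD rmorph1 /= -/(fpsX R).
have -> : 1 - fpsX R = 1 + fpsC (-1) * fpsX R by rewrite rmorphN rmorph1 mulN1r.
have -> : 1 + fpsX R = 1 + fpsC 1 * fpsX R by rewrite rmorph1 mul1r.
rewrite (theta_logM (theta_logX m (lin _)) (theta_logX n (lin _))).
by rewrite /eta !rmorph_nat; ring.
Qed.

Lemma binser2M (R : realType) (a b c d : R) :
  binser2 a b * binser2 c d = binser2 (a + c) (b + d).
Proof.
have E := theta_logM (theta_binser2 a b) (theta_binser2 c d).
apply: (log_deriv_uniq _ _ E); last first.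
  by rewrite theta_binser2 !rmorphD /=; ring.
  by rewrite coef_fpsM big_ord1 !binser20 mulr1.
have G (e : R) : (1 - geom e) 0%N = 0.
  rewrite coef_fpsB -[(1 : fps R) 0%N]/((1 : {poly R})`_0) coef1 /geom.
  by rewrite expr0 subrr.
by rewrite !coef_fpsD !coef_fpsCM !G !mulr0 !addr0.
Qed.

(** * The operators on constants *)

Section Constants.
Variable R : realType.

Lemma sphere_partial_cst n i (c : R) (x : sphere R n) :
  sphere_partial i (fun=> c) x = 0.
Proof. exact: derive_cst. Qed.

Lemma sphere_laplacian_cst n (c : R) (x : sphere R n) :
  sphere_laplacian (fun=> c) x = 0.
Proof.
rewrite /sphere_laplacian /sphere_div big1 // => i _.
rewrite -[RHS](@sphere_partial_cst n i 0 x); congr (sphere_partial i _ x).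
by apply/funext => t; rewrite mxE sphere_partial_cst.
Qed.

Variables q p : nat.
Local Notation cst c := ((fun=> c) : func R q p).
Let b : R := (q%:R - 1) / 2.
Let c : R := (p%:R - 1) / 2.
Let h : R := (p%:R + q%:R) / 2.
Let y : R := (q%:R - p%:R) / 2.

Lemma opB2_cst x : opB2 (cst x) = cst (b ^+ 2 * x).
Proof.
apply/funext => z.
by rewrite /opB2 /laplacian_q sphere_laplacian_cst oppr0 add0r.
Qed.
Lemma opC2_cst x : opC2 (cst x) = cst (c ^+ 2 * x).
Proof.
apply/funext => z.
by rewrite /opC2 /laplacian_p sphere_laplacian_cst oppr0 add0r.
Qed.
Lemma opD_cst x : opD (cst x) = cst ((b ^+ 2 - c ^+ 2) * x).
Proof. by rewrite /opD opB2_cst opC2_cst; apply/funext => z; ring. Qed.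

(** With B^2 and C^2 replaced by b^2 and c^2 for b = (q-1)/2, c = (p-1)/2, the
    k-th factor in the definition of P_{2N} is ((b + c)^2 - k^2) ((b - c)^2 -
    k^2), and b + c = h - 1, b - c = y. *)
Definition factor_one (k : nat) : R :=
  ((h - 1) ^+ 2 - k%:R ^+ 2) * (y ^+ 2 - k%:R ^+ 2).

Lemma gjms_factor_cst k x : gjms_factor k (cst x) = cst (factor_one k * x).
Proof.
rewrite /gjms_factor !opD_cst opB2_cst opC2_cst; apply/funext => z.
by rewrite /factor_one /b /c /h /y; field.
Qed.

Lemma compose_all_cst (F : nat -> func R q p -> func R q p) (f : nat -> R) s x :
  (forall j x, F j (cst x) = cst (f j * x)) ->
  compose_all [seq F j | j <- s] (cst x) = cst ((\prod_(j <- s) f j) * x).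
Proof.
move=> Ff; elim: s => [|j s IH] /=; first by rewrite big_nil mul1r.
by rewrite /= IH Ff big_cons mulrA.
Qed.

(** The new factors are those with k = 0 and k = N + 1; the others are
    shifted. *)
Lemma gjms_oneSS N :
  gjms_one h y N.+2 = factor_one N.+1 * gjms_one h y N.
Proof.
rewrite /gjms_one big_ord_recl big_ord_recr /=.
under eq_bigr => k _.
  have -> : h - N.+2%:R + 2 * (bump 0 k)%:R = h - N%:R + 2 * k%:R.
    by rewrite /bump add1n; ring.
  have -> : y + 1 - N.+2%:R + 2 * (bump 0 k)%:R = y + 1 - N%:R + 2 * k%:R.
    by rewrite /bump add1n; ring.
  over.
rewrite /factor_one /bump add1n.
move: h y (\prod_(k < N) _) => h1 y1 P.
rewrite 2!(exprS (-1)) -[N.+2%:R]natr1 -[N.+1%:R]natr1.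
ring.
Qed.

Lemma gjms_one_even M :
  gjms_one h y M.*2 = \prod_(j <- iota 1 M) factor_one (2 * j - 1).
Proof.
elim: M => [|M IH]; first by rewrite /gjms_one big_ord0 big_nil expr0 mulr1.
rewrite doubleS gjms_oneSS IH -[M.+1]addn1 iotaD big_cat big_seq1 mulrC.
by congr (_ * factor_one _); lia.
Qed.

Lemma gjms_one_odd M : gjms_one h y M.*2.+1 =
  - ((h - 1) * y) * \prod_(j <- iota 1 M) factor_one (2 * j).
Proof.
elim: M => [|M IH].
  by rewrite double0 /gjms_one big_ord1 big_nil expr1 /=; ring.
rewrite doubleS gjms_oneSS IH -[M.+1]addn1 iotaD big_cat big_seq1 /=.
have -> : M.*2.+2 = (2 * (1 + M))%N by lia.
ring.
Qed.

Lemma gjms_cst N x : gjms N (cst x) = cst (gjms_one h y N * x).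
Proof.
rewrite /gjms; have := odd_double_half N; case: (odd N) => /= EN.
  rewrite (@compose_all_cst _ (fun j => factor_one (2 * j))); last first.
    by move=> j t; apply: gjms_factor_cst.
  rewrite -{2}EN add1n gjms_one_odd opD_cst; apply/funext => z.
  rewrite !mulrA -!mulNr; congr (_ * _ * _).
  by rewrite /b /c /h /y; field.
rewrite (@compose_all_cst _ (fun j => factor_one (2 * j - 1))); last first.
  by move=> j t; apply: gjms_factor_cst.
by rewrite -{2}EN add0n gjms_one_even.
Qed.

Lemma gjms_comp_cst J x :
  gjms_comp J (cst x) = cst ((\prod_(j <- J) gjms_one h y j) * x).
Proof. exact: compose_all_cst gjms_cst. Qed.

(** m_I without the factorials of |I|: appending a part to I only multiplies
    the result by a factor depending on the last two parts ([m_norm_rcons]). *)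
Definition m_norm (I : seq nat) : R :=
  - (-1) ^+ size I
  * (\prod_(j < size I) ((nth 0%N I j)`!%:R * (nth 0%N I j).-1`!%:R)^-1)
  * (\prod_(j < (size I).-1) ((nth 0%N I j + nth 0%N I j.+1)%:R)^-1).

Lemma m_coefE I : m_coef R I = (sumn I)`!%:R * (sumn I).-1`!%:R * m_norm I.
Proof. by rewrite /m_coef /m_norm; ring. Qed.

Lemma m_norm1 a : m_norm [:: a] = (a`!%:R * a.-1`!%:R)^-1.
Proof. by rewrite /m_norm /= big_ord1 big_ord0 expr1 mulr1 opprK mul1r. Qed.

Lemma m_norm_rcons I b' a : m_norm (rcons (rcons I b') a) =
  - m_norm (rcons I b') * (a`!%:R * a.-1`!%:R)^-1 * (b' + a)%:R^-1.
Proof.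
have part (I' : seq nat) : \prod_(j < size I') ((nth 0%N I' j)`!%:R
    * (nth 0%N I' j).-1`!%:R)^-1 = \prod_(j <- I') (j`!%:R * j.-1`!%:R)^-1 :> R.
  by rewrite (big_nth 0%N) big_mkord.
rewrite /m_norm !part !big_rcons /= !size_rcons /= big_ord_recr /= exprS.
have -> : nth 0%N (rcons (rcons I b') a) (size I) = b'.
  by rewrite !nth_rcons size_rcons ltnS leqnn ltnn eqxx.
have -> : nth 0%N (rcons (rcons I b') a) (size I).+1 = a.
  by rewrite nth_rcons size_rcons ltnn eqxx.
rewrite (eq_bigr (fun j : 'I_(size I) =>
    ((nth 0%N (rcons I b') j + nth 0%N (rcons I b') j.+1)%:R)^-1)) => [|j _].
  ring.
rewrite [nth _ (rcons _ a) _]nth_rcons [nth _ (rcons _ a) _.+1]nth_rcons.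
by rewrite size_rcons !ltnS ltn_ord ltnW.
Qed.

(** The sign (-1)^r of m_I turns each P_{2J_i}(1) into - P_{2J_i}(1), as in
    [res_coef]. The composition is reversed because the part adjacent to a
    comes first in [comp_weight]. *)
Lemma m_norm_gjms J a : m_norm (rcons J a) * \prod_(j <- J) gjms_one h y j =
  (a`!%:R * a.-1`!%:R)^-1 * comp_weight h y a%:R (rev J).
Proof.
elim/last_ind: J a => [|J b' IH] a.
  by rewrite big_nil /= !mulr1 m_norm1.
rewrite m_norm_rcons rev_rcons /= big_rcons /= /res_coef -natrD (addnC a).
transitivity (- (m_norm (rcons J b') * \prod_(j <- J) gjms_one h y j) *
  gjms_one h y b' * (a`!%:R * a.-1`!%:R)^-1 * (b' + a)%:R^-1); first by ring.
by rewrite IH; ring.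
Qed.

Lemma perm_compositions_rev n :
  perm_eq (compositions n) [seq rev J | J <- compositions n].
Proof.
have rev_inj : injective (@rev nat) := can_inj revK.
apply: uniq_perm; rewrite ?map_inj_uniq ?uniq_compositions // => s.
by rewrite -[in RHS](revK s) mem_map // !mem_compositions all_rev sumn_rev.
Qed.

Lemma sum_m_coef_gjms N a : (0 < a < N)%N ->
  \sum_(J <- compositions (N - a)) m_coef R (rcons J a)
     * \prod_(j <- J) gjms_one h y j =
  N`!%:R * N.-1`!%:R * (a`!%:R * a.-1`!%:R)^-1 * comp_sum h y a%:R (N - a)%N.
Proof.
move=> aN; rewrite (perm_big _ (perm_compositions_rev _)) big_map.
rewrite /comp_sum mulr_sumr.
rewrite [LHS]big_seq [RHS]big_seq; apply: eq_bigr => J.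
rewrite mem_compositions => /andP[_ /eqP sJ].
have sN : sumn (rcons (rev J) a) = N by rewrite sumn_rcons sumn_rev sJ; lia.
by rewrite m_coefE sN -mulrA m_norm_gjms revK !mulrA.
Qed.

Lemma calGE (z : sphere R q * sphere R p) :
  calG z = binser2 (expo_minus h y) (expo_plus h y).
Proof.
apply/funext => -[|n]; first by rewrite binser20.
rewrite -calG_coefE /calG /= /Lambda /primaryQ.
set N := n.+1.
have nz : N`!%:R * n`!%:R != 0 :> R.
  by rewrite mulf_neq0 // pnatr_eq0 -lt0n fact_gt0.
(* The term a = N of [calG_coef], with empty J, is the contribution of Q_{2N}
   itself. *)
have sgnK (x s : R) : (-1) ^+ N * (x - (-1) ^+ N * - s) = s + (-1) ^+ N * x.
  by rewrite mulrBr mulrA -expr2 sqrr_sign mul1r opprK addrC.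
apply: (mulIf nz); rewrite divfK // /calG_coef sgnK big_ord_recr /= mulrDl.
rewrite subnn comp_sum0 mulr1; congr (_ + _).
  rewrite big_add1 big_mkord mulr_suml; apply: eq_bigr => a _ /=.
  have aN : (0 < a.+1 < N)%N by rewrite /= ltnS.
  under eq_bigr do rewrite gjms_comp_cst.
  transitivity ((\sum_(J <- compositions (N - a.+1)) m_coef R (rcons J a.+1)
     * \prod_(j <- J) gjms_one h y j) * ((-1) ^+ a.+1 * Qval h y a.+1)).
    rewrite mulr_suml; apply: eq_bigr => J _.
    rewrite -[Qcurv _ _ _ _]/(Qval h y a.+1); ring.
  by rewrite sum_m_coef_gjms // /Qres; ring.
by rewrite /Qres divfK.
Qed.
End Constants.

Theorem corollary9p1 (R : realType) (q p : nat) (hq : (0 < q)%N) (hp : (0 < p)%N)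
    (z : sphere R q * sphere R p) :
  fps_subst (calG z) (4^-1 *: 'X^2) =1
    fps_sqrt (fps_of_poly (vol_ratio R q p)).
Proof.
have u0 : (4^-1 *: 'X^2 : {poly R})`_0 = 0 by rewrite coefZ coefXn mulr0.
apply: fps_sqrt_unique => [|n].
  by rewrite /fps_subst big_ord1 expr0 coef1 mulr1.
set s := fps_subst _ _; rewrite -[fps_mul s s]/(s * s) /s.
rewrite -fps_substM // calGE binser2M.
have -> : expo_minus ((p%:R + q%:R) / 2) ((q%:R - p%:R) / 2 : R) +
   expo_minus ((p%:R + q%:R) / 2) ((q%:R - p%:R) / 2) = q%:R.
  by rewrite /expo_minus; field.
have -> : expo_plus ((p%:R + q%:R) / 2) ((q%:R - p%:R) / 2 : R) +
   expo_plus ((p%:R + q%:R) / 2) ((q%:R - p%:R) / 2) = p%:R.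
  by rewrite /expo_plus; field.
rewrite binser2_nat fps_subst_poly // rmorphM !rmorphXn /=.
by rewrite comp_polyB comp_polyD !comp_polyC !comp_polyX.
Qed.
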